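(* Let $q,r,n$ be positive integers with $q\ge r-1\ge 2$, and let $q=p_1^{e_1}\cdots p_s^{e_s}$ be the canonical integer factorization of $q$, where $p_1,\ldots,p_s$ are distinct primes, $e_1,\ldots,e_s$ are positive integers, and $p_1^{e_1}<\cdots<p_s^{e_s}$. If $(r-1)\mid(n+1)$ and $2r-3<n\le p_1^{e_1}+1$, then $$f_r^{q}(n)=q^{\lceil\frac{(r-2)n}{r-1}\rceil}.$$
   Context: Write $[q]=\{1,\ldots,q\}$. For $r\ge 3$, a family of $r$ distinct vectors $\boldsymbol{x}^0,\boldsymbol{x}^1,\ldots,\boldsymbol{x}^{r-1}\in[q]^n$ is an $r$-focal code with focus $\boldsymbol{x}^0$ if for every coordinate $i\in[n]$ we have $|\{j\in[r-1]:x_i^j=x_i^0\}|\ge r-2$. A code $\mathcal{C}\subseteq[q]^n$ is $r$-focal-free if it does not contain an $r$-focal code as a subset. $f_r^{q}(n)$ denotes the maximum cardinality of an $r$-focal-free code in $[q]^n$. *)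

(* Defs.v *)
From HB Require Import structures.
From mathcomp Require Import all_boot all_order all_algebra.

Set Implicit Arguments.
Unset Strict Implicit.
Unset Printing Implicit Defensive.

Definition word (q n : nat) := {ffun 'I_n -> 'I_q}.

(* The focus x^0 is the separate argument [x0]; the other vectors
   x^1, ..., x^(r-1) are indexed from 0 by ['I_(r - 1)]. The first two
   conditions say that the r vectors are pairwise distinct. *)
Definition focal_code (r q n : nat) (x0 : word q n)
    (x : {ffun 'I_(r - 1) -> word q n}) : bool :=
  [&& injectiveb x,
      [forall j, x j != x0] &
      [forall i : 'I_n, r - 2 <= #|[set j | x j i == x0 i]|]].

Definition focal_free (r q n : nat) (C : {set word q n}) : bool :=
  ~~ [exists x0 : word q n, exists x : {ffun 'I_(r - 1) -> word q n},
      [&& focal_code x0 x, x0 \in C & [forall j, x j \in C]]].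

Definition max_focal_free (r q n : nat) : nat :=
  \max_(C : {set word q n} | focal_free r C) #|C|.

(* Main.v *)
(* Put k = r - 1 and n + 1 = km, so that the exponent is (k - 1)m.

   Lower bound: an MDS code of dimension (k - 1)m has minimum distance m, while
   in an r-focal code the k sets of coordinates where x^j differs from the focus
   are disjoint, so that they would need km > n coordinates.  MDS codes over
   prime power alphabets are extended Reed-Solomon codes, and products of
   alphabets preserve them.

   Upper bound: call a codeword x own for S if no other codeword agrees with x
   outside S, and let G(S) count these codewords.  In a focal-free code, every
   partition of the coordinates into k parts P_j gives |C| <= sum_j G(P_j).
   Moreover G(S) + (q - 1) G(S + i) <= q^(n - |S|) for i not in S.  Choose an
   m-set T maximizing G, take T - i for one part and m-sets for the k - 1 others:
   |C| <= G(T - i) + (k - 1) G(T) <= q^(n - m + 1), since k <= q. *)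
Require Import Defs.
From HB Require Import structures.
From mathcomp Require Import all_boot all_order all_algebra.
From mathcomp Require Import finfield zify.

Set Implicit Arguments.
Unset Strict Implicit.
Unset Printing Implicit Defensive.

Import GRing.Theory Num.Theory.

(** * Own codewords and the upper bound *)

Definition own (q n : nat) (C : {set word q n}) (S : {set 'I_n}) :
    {set word q n} :=
  [set x in C | [forall y in C,
     [forall i, (i \notin S) ==> (y i == x i)] ==> (y == x)]].

Lemma ownP (q n : nat) (C : {set word q n}) (S : {set 'I_n}) (x : word q n) :
  reflect (x \in C /\ forall y, y \in C ->
             (forall i, i \notin S -> y i = x i) -> y = x)
          (x \in own C S).
Proof.
rewrite inE; apply: (iffP andP) => -[xC xown]; split=> //.
  move=> y yC yx; apply/eqP.
  move/forall_inP: xown => /(_ y yC) /implyP; apply.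
  by apply/forallP=> i; apply/implyP=> iS; apply/eqP/yx.
apply/forall_inP=> y yC; apply/implyP=> /forallP yx; apply/eqP/xown => // i iS.
by apply/eqP; apply: (implyP (yx i)).
Qed.

Lemma own_mono (q n : nat) (C : {set word q n}) (S T : {set 'I_n}) :
  S \subset T -> own C T \subset own C S.
Proof.
move=> /subsetP ST; apply/subsetP=> x /ownP[xC xT]; apply/ownP; split=> // y yC yx.
by apply: xT => // i iT; apply: yx; apply: contra iT; apply: ST.
Qed.

(* If x lies in none of these sets, then for every part j some other codeword
   differs from x only inside part j, and these form a focal code at x. *)
Lemma focal_free_own_cover (r q n : nat) (C : {set word q n})
    (g : 'I_n -> 'I_(r - 1)) :
  focal_free r C -> #|C| <= \sum_j #|own C [set i | g i == j]|.
Proof.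
move=> free.
suff /subset_leq_card le : C \subset \bigcup_j own C [set i | g i == j].
  apply: leq_trans le _.
  elim/big_rec2: _ => [|j a A _ le]; first by rewrite cards0.
  by apply: leq_trans (leq_card_setU _ _) _; rewrite leq_add2l.
apply/subsetP=> x xC; apply: contraT => xU; case/negP: free.
have /fin_all_exists[y yP] (j : 'I_(r - 1)) : exists y : word q n,
    [/\ y \in C, y != x & forall i, g i != j -> y i = x i].
  have: x \notin own C [set i | g i == j].
    by apply: contra xU => xj; apply/bigcupP; exists j.
  rewrite inE xC /= negb_forall_in => /exists_inP[y yC].
  rewrite negb_imply => /andP[/forallP yx nyx]; exists y; split=> // i gi.
  by apply/eqP; apply: (implyP (yx i)); rewrite inE.
apply/existsP; exists x; apply/existsP; exists [ffun j => y j].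
rewrite xC /=; apply/andP; split; last first.
  by apply/forallP=> j; rewrite ffunE; case: (yP j).
apply/and3P; split.
(* If [y j = y l] with [j != l], this word agrees with [x] outside two disjoint parts, hence
   everywhere. *)
- apply/injectiveP=> j l; rewrite !ffunE => yjl; apply: contraTeq isT => njl.
  have [_ /eqP yjx yj] := yP j; have [_ _ yl] := yP l.
  case: yjx; apply/ffunP=> i; have [gi|] := eqVneq (g i) j; last exact: yj.
  by rewrite yjl yl // gi.
- by apply/forallP=> j; rewrite ffunE; case: (yP j).
- apply/forallP=> i.
  have -> : r - 2 = #|[set~ g i]| by rewrite cardsC1 card_ord; lia.
  apply: subset_leq_card; apply/subsetP=> j; rewrite !inE ffunE => ji.
  by apply/eqP; case: (yP j) => _ _ -> //; rewrite eq_sym.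
Qed.

(* Delete the coordinates in S.  If x is own for [i |: S], then each of the q
   words obtained by changing x in coordinate i is hit by x only, so that x
   uses up q words of length n - #|S|; if x is own for S only, it uses up one. *)
Lemma card_own_add1 (q n : nat) (C : {set word q n}) (S : {set 'I_n}) (i : 'I_n) :
  0 < q -> i \notin S ->
  #|own C S| + (q - 1) * #|own C (i |: S)| <= q ^ (n - #|S|).
Proof.
move=> q0 iS; pose o := Ordinal q0.
pose G := own C S; pose G' := own C (i |: S).
have sG : G' \subset G by apply/own_mono/subsetU1.
(* [z.2] is the letter put at coordinate [i], free only when [z.1] is own for [i |: S]. Filling [S]
   with [o] in [psi] amounts to deleting it. *)
pose D := [set z : word q n * 'I_q | (z.1 \in G) && ((z.1 \in G') || (z.2 == z.1 i))].
pose psi (z : word q n * 'I_q) : word q n :=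
  [ffun l => if l \in S then o else if l == i then z.2 else z.1 l].
have cardD : #|D| = #|G| + (q - 1) * #|G'|.
  have -> : #|D| = \sum_(x in G) (if x \in G' then q else 1).
    rewrite -sum1_card (eq_bigl (fun z => (z.1 \in G) &&
      ((z.1 \in G') || (z.2 == z.1 i)))); last by move=> z; rewrite inE.
    rewrite -(pair_big_dep (mem G) (fun x c => (x \in G') || (c == x i)) (fun _ _ => 1)) /=.
    apply: eq_bigr => x xG; case: ifP => _ /=.
      by rewrite sum1_card card_ord.
    by rewrite sum1_card card1.
  rewrite (eq_bigr (fun x => 1 + (if x \in G' then q - 1 else 0))); last first.
    by move=> x _; case: ifP => _; lia.
  rewrite big_split /= sum1_card -big_mkcondr /=; congr (_ + _).
  rewrite (eq_bigl (mem G')); first by rewrite sum_nat_const mulnC.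
  by move=> x /=; have [/(subsetP sG) ->|_] := boolP (x \in G'); rewrite ?andbF.
have injD : {in D &, injective psi}.
  move=> [x c] [y d]; rewrite 2![_ \in D]in_set /= => /andP[xG xG'] /andP[yG yG'] /ffunP e.
  have ecd : c = d.
    by have := e i; rewrite !ffunE (negPf iS) eqxx.
  have exy l : l \notin i |: S -> x l = y l.
    rewrite !inE negb_or => /andP[li lS].
    by have := e l; rewrite !ffunE (negPf lS) (negPf li).
  have xC : x \in C by case/ownP: xG.
  have yC : y \in C by case/ownP: yG.
  suff -> : x = y by rewrite ecd.
  (* If one word is own for [i |: S], agreement outside that set suffices; otherwise [c] and [d] are
     the original letters, so the words agree at [i] too. *)
  case/orP: xG' => [/ownP[_ xo]|/eqP cx]; first by apply/esym/xo => // l /exy.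
  case/orP: yG' => [/ownP[_ yo]|/eqP dy]; first exact: yo.
  case/ownP: yG => _; apply=> // l lS.
  have [->|li] := eqVneq l i; first by rewrite -cx -dy.
  by apply: exy; rewrite !inE negb_or li.
rewrite -cardD -(card_in_imset injD).
have -> : q ^ (n - #|S|) = #|pffun_on o (mem (~: S)) (mem [set: 'I_q])|.
  by rewrite card_pffun_on cardsT (cardsCs (~: S)) setCK !card_ord.
apply: subset_leq_card; apply/subsetP=> _ /imsetP[z _ ->].
apply/pffun_onP; split; last by move=> ? _; rewrite inE.
by apply/supportP=> l; rewrite inE negbK => lS; rewrite ffunE lS.
Qed.

(** List [S] first, then its complement, and cut the list into blocks of length [m]. Positions are
    shifted by one, so that block 0 loses one place and is exactly [S]. *)
Lemma exists_blocks (n k m : nat) (S : {set 'I_n}) :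
  0 < m -> n + 1 = k * m -> #|S| = m - 1 ->
  exists g : 'I_n -> 'I_k,
    (forall j : 'I_k, (j : nat) = 0 -> [set i | g i == j] = S) /\
    (forall j : 'I_k, 0 < j -> #|[set i | g i == j]| = m).
Proof.
move=> m0 nkm cS.
pose s := enum S ++ enum (~: S).
have size_s : size s = n.
  by rewrite size_cat -!cardE cardsC card_ord.
have mem_s i : i \in s by rewrite mem_cat !mem_enum inE orbN.
have uniq_s : uniq s.
  rewrite cat_uniq !enum_uniq andbT /=; apply/hasPn=> i.
  by rewrite !mem_enum inE.
have gP (i : 'I_n) : (index i s).+1 %/ m < k.
  by rewrite ltn_divLR // -nkm addn1 ltnS -{2}size_s index_mem.
exists (fun i => Ordinal (gP i)); split=> j j0.
  apply/setP=> i; rewrite inE -val_eqE /= j0 -leqn0 leqNgt divn_gt0 // -ltnNge.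
  rewrite index_cat mem_enum; have [iS|_] := boolP (i \in S).
    by move: iS; rewrite -mem_enum -index_mem -cardE cS ltn_subRL add1n.
  by rewrite -cardE cS; apply/negbTE; lia.
have jk : j < k by [].
have pos_lt (b : 'I_m) : (j * m + b).-1 < n.
  have bm := ltn_ord b.
  have : j * m + b < k * m.
    by apply: leq_trans (_ : j.+1 * m <= _); rewrite ?leq_mul2r ?jk ?orbT // mulSn; lia.
  lia.
have pos_gt (b : 'I_m) : 0 < j * m + b by rewrite addn_gt0 muln_gt0 j0 m0.
pose h (b : 'I_m) : 'I_n := nth (Ordinal (pos_lt b)) s (j * m + b).-1.
have index_h b : index (h b) s = (j * m + b).-1.
  by rewrite index_uniq // size_s.
have inj_h : injective h.
  move=> b c /(congr1 (index^~ s)); rewrite !index_h => e.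
  by apply/val_inj => /=; have := pos_gt b; have := pos_gt c; lia.
rewrite -[RHS]card_ord -(card_imset _ inj_h); congr #|pred_of_set _|.
apply/setP=> i; rewrite inE -val_eqE /=; apply/eqP/imsetP => [e|[b _ ->]].
  have bm : (index i s).+1 %% m < m by rewrite ltn_mod.
  exists (Ordinal bm) => //; apply: (@index_inj _ i s); rewrite ?mem_s //.
  by rewrite index_h /= -e -divn_eq.
by rewrite index_h prednK // divnMDl // divn_small ?addn0.
Qed.

Lemma focal_free_upper (r q n m : nat) (C : {set word q n}) :
  r - 1 <= q -> 2 <= r - 1 -> 0 < m -> n + 1 = (r - 1) * m ->
  focal_free r C -> #|C| <= q ^ ((r - 2) * m).
Proof.
move=> rq r2 m0 nkm free.
have mn : m <= n by have : 2 * m <= (r - 1) * m; [rewrite leq_mul2r r2 orbT|lia].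
have [T0 T0m] : exists T : {set 'I_n}, #|T| == m.
  have: 0 < #|[set A : {set 'I_n} | A \subset setT & #|A| == m]|.
    by rewrite cards_draws cardsT card_ord bin_gt0.
  by case/card_gt0P=> T; rewrite inE => /andP[_]; exists T.
case: (@arg_maxnP _ T0 (fun T => #|T| == m) (fun T => #|own C T|) T0m) => T /eqP Tm Tmax.
have /card_gt0P[i iT] : 0 < #|T| by rewrite Tm.
have cS : #|T :\ i| = m - 1 by have := cardsD1 i T; rewrite iT Tm; lia.
have [g [gS gT]] := exists_blocks m0 nkm cS.
have k0 : 0 < r - 1 by lia.
apply: leq_trans (focal_free_own_cover g free) _.
rewrite (bigD1 (Ordinal k0)) //= gS //.
have: \sum_(j < r - 1 | j != Ordinal k0) #|own C [set i | g i == j]| <=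
      (r - 2) * #|own C T|.
  have -> : r - 2 = #|[set~ Ordinal k0]| by rewrite cardsC1 card_ord; lia.
  rewrite -sum_nat_const [leqRHS](eq_bigl (fun j => j != Ordinal k0)); last first.
    by move=> j; rewrite !inE.
  apply: leq_sum => j; rewrite -val_eqE /= -lt0n => j0; apply: Tmax.
  by apply/eqP/gT.
have q0 : 0 < q by lia.
have iS : i \notin T :\ i by rewrite !inE eqxx.
have := card_own_add1 C q0 iS; rewrite setD1K // cS.
have -> : n - (m - 1) = (r - 2) * m.
  by rewrite (_ : r - 2 = r - 1 - 1); [rewrite mulnBl|]; lia.
move=> line rest; apply: leq_trans line; rewrite leq_add2l.
(* This is where [r - 1 <= q] enters, as [r - 2 <= q - 1]. *)
by apply: leq_trans rest _; rewrite leq_mul2r; lia.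
Qed.

(** * MDS codes over prime powers and products *)

(** Encoder form of an MDS code: distinct messages have codewords agreeing in fewer than [K] places.
    The alphabet is any finite type, to allow fields and products. *)
Definition has_mds (n K : nat) (A : finType) : Prop :=
  exists E : {ffun 'I_K -> A} -> {ffun 'I_n -> A},
    forall u v, K <= #|[set i | E u i == E v i]| -> u = v.

Lemma has_mds_card (n K : nat) (A B : finType) :
  #|A| = #|B| -> has_mds n K A -> has_mds n K B.
Proof.
move=> cAB [E EP].
pose g (a : A) : B := enum_val (cast_ord cAB (enum_rank a)).
have [f gK fK] : bijective g.
  exists (fun b => enum_val (cast_ord (esym cAB) (enum_rank b))) => a.
    by rewrite /g enum_valK cast_ordK enum_rankK.
  by rewrite /g enum_valK cast_ordKV enum_rankK.
exists (fun u => [ffun i => g (E [ffun j => f (u j)] i)]) => u v le.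
suff /ffunP e : [ffun j => f (u j)] = [ffun j => f (v j)].
  by apply/ffunP=> j; have := e j; rewrite !ffunE => /(can_inj fK).
apply: EP; apply: leq_trans le _; apply/subset_leq_card/subsetP=> i.
by rewrite !inE !ffunE => /eqP/(can_inj gK)->.
Qed.

Lemma has_mds_prod (n K : nat) (A B : finType) :
  has_mds n K A -> has_mds n K B -> has_mds n K (A * B)%type.
Proof.
move=> [E EP] [F FP].
exists (fun u => [ffun i => (E [ffun j => (u j).1] i, F [ffun j => (u j).2] i)]).
move=> u v le.
have /ffunP e1 : [ffun j => (u j).1] = [ffun j => (v j).1].
  apply: EP; apply: leq_trans le _; apply/subset_leq_card/subsetP=> i.
  by rewrite !inE !ffunE => /eqP[-> _].
have /ffunP e2 : [ffun j => (u j).2] = [ffun j => (v j).2].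
  apply: FP; apply: leq_trans le _; apply/subset_leq_card/subsetP=> i.
  by rewrite !inE !ffunE => /eqP[_ ->].
apply/ffunP=> j; have := e1 j; have := e2 j; rewrite !ffunE.
by case: (u j) (v j) => ? ? [? ?] /= -> ->.
Qed.

(* Extended Reed-Solomon code: evaluate a polynomial of degree < K at n points
   of the projective line, its value at infinity being the coefficient of
   degree K - 1. *)
Lemma has_mds_field (n K : nat) (F : finFieldType) :
  0 < K -> n <= #|F| + 1 -> has_mds n K F.
Proof.
move=> K0; rewrite addn1 -card_option => nF.
pose t (i : 'I_n) : option F := enum_val (widen_ord nF i).
have t_inj : injective t by move=> i j /enum_val_inj/(congr1 val)/= /val_inj.
pose P (u : {ffun 'I_K -> F}) : {poly F} :=
  (\poly_(j < K) (if insub j is Some l then u l else 0))%R.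
have coefP u (l : 'I_K) : ((P u)`_l)%R = u l.
  by rewrite coef_poly ltn_ord valK.
pose ev (p : {poly F}) (a : option F) : F :=
  (if a is Some b then p.[b] else p`_K.-1)%R.
exists (fun u => [ffun i => ev (P u) (t i)]) => u v le.
suff /eqP : (P u - P v = 0)%R.
  rewrite subr_eq0 => /eqP e.
  by apply/ffunP=> l; rewrite -!coefP e.
apply/eqP; apply: contraTT le => nz; rewrite -ltnNge.
set p := (P u - P v)%R in nz *.
(* An agreement at infinity lowers the degree bound by one, and so costs one root. *)
have size_p : size p <= K - (p`_K.-1 == 0)%R.
  have sizeK : size p <= K.
    apply: leq_trans (size_polyD _ _) _.
    by rewrite size_polyN geq_max !size_poly.
  case: eqP => [p0|_]; last by rewrite subn0.
  rewrite subn1 -ltnS prednK // ltn_neqAle sizeK andbT.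
  apply: contra_neq nz => sK; apply/eqP.
  by rewrite -lead_coef_eq0 /lead_coef sK p0.
pose A := [set a | root p a].
have cA : #|A| < size p.
  rewrite cardE; apply: max_poly_roots => //; last exact: enum_uniq.
  by apply/allP=> a; rewrite mem_enum inE.
pose N := (if p`_K.-1 == 0 then [set None] else set0 : {set option F})%R.
have cN : #|N| = (p`_K.-1 == 0)%R by rewrite /N; case: ifP; rewrite ?cards1 ?cards0.
rewrite -(card_imset _ t_inj).
apply: leq_ltn_trans (_ : #|Some @: A :|: N| < _).
  apply/subset_leq_card/subsetP=> _ /imsetP[i + ->].
  rewrite !inE !ffunE -subr_eq0.
  case: (t i) => [a|] /= e; apply/orP.
    left; apply/imsetP; exists a => //.
    by rewrite inE /root hornerD hornerN.
  by right; rewrite /N coefB e inE.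
apply: leq_ltn_trans (leq_card_setU _ _) _.
rewrite card_imset; last by move=> ? ? [].
rewrite cN; have : 0 < size p by rewrite size_poly_gt0.
by have := leq_b1 (p`_K.-1 == 0)%R; lia.
Qed.

(** * Lower bound *)

Lemma focal_free_lower (r q n m : nat) :
  2 <= r - 1 -> 0 < m -> n + 1 = (r - 1) * m -> has_mds n ((r - 2) * m) 'I_q ->
  exists2 C : {set word q n}, focal_free r C & #|C| = q ^ ((r - 2) * m).
Proof.
move=> r2 m0 nkm [E EP]; set K := (r - 2) * m in E EP *.
have nK : n + 1 = K + m.
  by rewrite nkm /K -mulSnr; congr (_ * _); lia.
have E_inj : injective E.
  move=> u v e; apply: EP; rewrite e (_ : [set i | _] = setT); last first.
    by apply/setP=> i; rewrite !inE eqxx.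
  by rewrite cardsT card_ord; lia.
exists [set E u | u : {ffun 'I_K -> 'I_q}]; last first.
  by rewrite card_imset // card_ffun !card_ord.
apply/negP=> /existsP[x0 /existsP[x /and3P[/and3P[_ /forallP nx /forallP foc]]]].
move=> /imsetP[u0 _ e0] /forallP xC.
pose D j := [set i | x j i != x0 i].
have dist j : m <= #|D j|.
  have /imsetP[u _ e] := xC j; rewrite leqNgt; apply/negP=> lt.
  have /eqP[] := nx j; rewrite e e0; congr E; apply: EP.
  have -> : [set i | E u i == E u0 i] = ~: D j.
    by apply/setP=> i; rewrite !inE negbK e e0.
  by have := cardsC (D j); rewrite card_ord; lia.
(* Double counting: at each coordinate the focal condition lets at most one [x j] differ from
   [x0]. *)
have : \sum_(j < r - 1) #|D j| <= n.
  under eq_bigr do rewrite -sum1_card.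
  rewrite (exchange_big_dep predT) //= -[leqRHS]card_ord -sum1_card.
  apply: leq_sum => i _; rewrite sum1_card.
  rewrite (eq_card (B := ~: [set j | x j i == x0 i])); last first.
    by move=> j; rewrite -[LHS]/(i \in D j) !inE.
  have := cardsC [set j | x j i == x0 i]; rewrite card_ord.
  move=> cD; rewrite -(leq_add2l (r - 2)).
  by apply: leq_trans (leq_add (foc i) (leqnn _)) _; rewrite cD; lia.
have : \sum_(j < r - 1) m <= \sum_(j < r - 1) #|D j| by apply: leq_sum => j _; apply: dist.
by rewrite sum_nat_const card_ord; lia.
Qed.

(** * The exponent and the conclusion *)

Lemma ceil_div_nat (a b c : nat) :
  0 < b -> a <= c * b -> c * b < a + b ->
  `|Num.ceil (a%:R / b%:R : rat)%R| = c.
Proof.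
move=> b0 ac ca.
rewrite (ceil_def (m := c%:Z)) ?absz_nat //.
have b0' : (0 < b%:R :> rat)%R by rewrite ltr0n.
rewrite ltr_pdivlMr // ler_pdivrMr //.
rewrite intrD mulrDl mulN1r ltrBlDr.
by rewrite -natrM -natrD ltr_nat ler_nat ca.
Qed.

Theorem theorem1p6 (q r n : nat) (s : nat) (p e : 'I_s.+1 -> nat)
  (hq0 : 0 < q) (hr0 : 0 < r) (hn0 : 0 < n)
  (hqr : r - 1 <= q) (hr : 2 <= r - 1)
  (hp : forall i, prime (p i)) (hpinj : injective p)
  (he : forall i, 0 < e i)
  (hfact : q = \prod_(i < s.+1) p i ^ e i)
  (hord : forall i j : 'I_s.+1, i < j -> p i ^ e i < p j ^ e j)
  (hdvd : r - 1 %| n + 1)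
  (hn1 : 2 * r - 3 < n) (hn2 : n <= p ord0 ^ e ord0 + 1) :
  max_focal_free r q n =
    q ^ `|Num.ceil (((r - 2) * n)%:R / (r - 1)%:R : rat)%R|.
Proof.
have [m nkm] : exists m, n + 1 = (r - 1) * m.
  by case/dvdnP: hdvd => m ->; exists m; rewrite mulnC.
have m0 : 0 < m by case: m nkm => //; rewrite muln0; lia.
(* [(r - 2) * n] falls short of [(r - 1) * ((r - 2) * m)] by [r - 2], less than the divisor. *)
have -> : `|Num.ceil (((r - 2) * n)%:R / (r - 1)%:R : rat)%R| = (r - 2) * m.
  have r1 : r - 1 = (r - 2) + 1 by lia.
  by apply: ceil_div_nat; rewrite r1 in nkm *; nia.
have mds : has_mds n ((r - 2) * m) 'I_q.
  have K0 : 0 < (r - 2) * m by rewrite muln_gt0 m0 andbT; lia.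
  rewrite hfact; elim/big_ind: _ => [|a b Ha Hb|i _].
  (* The empty product is a one-letter alphabet, where all messages coincide. *)
  - exists (fun=> [ffun=> ord0]) => u v _; apply/ffunP=> j.
    by rewrite (ord1 (u j)) (ord1 (v j)).
  - by apply: has_mds_card (has_mds_prod Ha Hb); rewrite card_prod !card_ord.
  - have [F _ cF] := pPrimePowerField (hp i) (he i).
    apply: (@has_mds_card _ _ F); first by rewrite cF card_ord.
    apply: has_mds_field => //; rewrite cF; apply: leq_trans hn2 _.
    (* The first prime power is the smallest, so the bound on [n] serves every factor. *)
    rewrite leq_add2r; have [->//|ni] := eqVneq i ord0.
    by apply/ltnW/hord; rewrite lt0n; apply: contra_neq ni => i0; apply: val_inj.
apply/eqP; rewrite eqn_leq; apply/andP; split.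
  by apply/bigmax_leqP=> C; apply: focal_free_upper.
have [C free <-] := focal_free_lower hr m0 nkm mds.
exact: (@leq_bigmax_cond _ (focal_free r (n:=n)) (fun D => #|D|)).
Qed.
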